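(* Let $\Delta$ be a finite thin chamber complex equipped with a map $(F,C)\mapsto FC$ from faces times chambers to chambers satisfying the projection axioms (P1)–(P3). For chambers $C,D$ let $R_C(D)$ be the face of $D$ spanned by the vertices $v$ of $D$ with $(D\setminus v)C\ne D$, and let $\le_C$ be the transitive closure of the relation ''$E\le_C D$ if $R_C(E)\le D$''. Let $C\mapsto\overline{C}$ be a map from the set of chambers to itself. Then the following are equivalent: (P4) for every codimension-one face $G$ of $\Delta$ and every chamber $C$, $GC\neq G\overline{C}$; (R4) for all chambers $C,D$, $R_C(D)$ and $R_{\overline{C}}(D)$ are complementary faces of $D$ (their vertex sets partition the vertex set of $D$; in the labelled case, the type of $R_C(D)$ is $I$ minus the type of $R_{\overline{C}}(D)$); (S4) for every chamber $C$, the partial orders $\le_C$ and $\le_{\overline{C}}$ are dual (reverse) to each other.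
   Context: A chamber complex is a finite pure simplicial complex (chambers = maximal faces) in which any two chambers are joined by a gallery (sequence of chambers, consecutive ones sharing a codimension-one face). Thin: every codimension-one face lies in exactly two chambers. $F\le G$ is the face relation, $G\lessdot D$ means $G$ is a codimension-one face of $D$, $D\setminus v$ is the codimension-one face of $D$ not containing $v$. Axioms: (P1)(i) $FC=D\Rightarrow F\le D$; (ii) $F\le C\Rightarrow FC=C$; (iii) $FC=D$, $F\le G\le D\Rightarrow GC=D$; (P2) if $F\le D$ and $GC=D$ for all $G$ with $F\le G\lessdot D$ then $FC=D$; (P3) if $FC=D$ and $C_1,\dots,C_n=D$ is a weak $C$-gallery (faces $F_i$ with $F_iC=C_i$ and $F_i\le C_i,C_{i+1}$) then $FC_1=D$. *)

(* Defs.v *)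
From mathcomp Require Import all_boot.
From Stdlib Require Import Relation_Operators.

Set Implicit Arguments.
Unset Strict Implicit.
Unset Printing Implicit Defensive.

(* Faces are identified with their vertex sets; the empty face is a face, and  *)
(* the elements of V that lie in no face of Delta play no role.                *)

Definition simplicial_complex (V : finType) (Delta : {set {set V}}) : Prop :=
  set0 \in Delta /\
  forall F D : {set V}, D \in Delta -> F \subset D -> F \in Delta.

Definition chambers (V : finType) (Delta : {set {set V}}) : {set {set V}} :=
  [set C : {set V} | maxset (mem Delta) C].

Definition pure (V : finType) (Delta : {set {set V}}) : Prop :=
  forall C D, C \in chambers Delta -> D \in chambers Delta -> #|C| = #|D|.

Definition codim1_in (V : finType) (G D : {set V}) : bool :=
  (G \subset D) && (#|D| == #|G|.+1).

Definition codim1_face (V : finType) (Delta : {set {set V}}) (G : {set V}) :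
    bool :=
  [exists D in chambers Delta, codim1_in G D].

Definition adjacent (V : finType) : rel {set V} :=
  [rel C D | [exists G : {set V}, codim1_in G C && codim1_in G D]].

Definition gallery (V : finType) (Delta : {set {set V}})
    (C : {set V}) (p : seq {set V}) : bool :=
  all (mem (chambers Delta)) (C :: p) && path (@adjacent V) C p.

Definition chamber_complex (V : finType) (Delta : {set {set V}}) : Prop :=
  [/\ simplicial_complex Delta,
      pure Delta
    & forall C D, C \in chambers Delta -> D \in chambers Delta ->
      exists2 p, gallery Delta C p & last C p = D].

Definition thin (V : finType) (Delta : {set {set V}}) : Prop :=
  forall G, codim1_face Delta G ->
    #|[set D in chambers Delta | G \subset D]| = 2.

(* A projection map is given by a total function proj, with proj F C = FC; its *)
(* values are only constrained, and only used, for F a face and C a chamber.   *)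
Definition projection_map (V : finType) (Delta : {set {set V}})
    (proj : {set V} -> {set V} -> {set V}) : Prop :=
  forall F C, F \in Delta -> C \in chambers Delta ->
    proj F C \in chambers Delta.

Definition weak_step (V : finType) (Delta : {set {set V}})
    (proj : {set V} -> {set V} -> {set V}) (C : {set V}) : rel {set V} :=
  [rel X Y | [exists F in Delta,
    [&& proj F C == X, F \subset X & F \subset Y]]].

Definition weak_gallery (V : finType) (Delta : {set {set V}})
    (proj : {set V} -> {set V} -> {set V}) (C : {set V})
    (C1 : {set V}) (p : seq {set V}) : bool :=
  all (mem (chambers Delta)) (C1 :: p) && path (weak_step Delta proj C) C1 p.

Record projection_axioms (V : finType) (Delta : {set {set V}})
    (proj : {set V} -> {set V} -> {set V}) : Prop := ProjectionAxioms {
  axP1i : forall F C D, F \in Delta ->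
    C \in chambers Delta -> D \in chambers Delta ->
    proj F C = D -> F \subset D;
  axP1ii : forall F C, F \in Delta -> C \in chambers Delta ->
    F \subset C -> proj F C = C;
  axP1iii : forall F G C D, F \in Delta -> G \in Delta ->
    C \in chambers Delta -> D \in chambers Delta ->
    proj F C = D -> F \subset G -> G \subset D -> proj G C = D;
  axP2 : forall F C D, F \in Delta ->
    C \in chambers Delta -> D \in chambers Delta ->
    F \subset D ->
    (forall G : {set V}, F \subset G -> codim1_in G D -> proj G C = D) ->
    proj F C = D;
  axP3 : forall F C D C1 p, F \in Delta ->
    C \in chambers Delta -> D \in chambers Delta ->
    proj F C = D ->
    weak_gallery Delta proj C C1 p -> last C1 p = D ->
    proj F C1 = D }.

Definition restriction (V : finType) (proj : {set V} -> {set V} -> {set V})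
    (C D : {set V}) : {set V} :=
  [set v in D | proj (D :\ v) C != D].

Definition le_gen (V : finType) (Delta : {set {set V}})
    (proj : {set V} -> {set V} -> {set V}) (C E D : {set V}) : Prop :=
  [/\ E \in chambers Delta, D \in chambers Delta
    & restriction proj C E \subset D].

Definition le_chamber (V : finType) (Delta : {set {set V}})
    (proj : {set V} -> {set V} -> {set V}) (C : {set V}) :
    {set V} -> {set V} -> Prop :=
  clos_trans {set V} (le_gen Delta proj C).

Definition complementary_in (V : finType) (D A B : {set V}) : Prop :=
  A :|: B = D /\ [disjoint A & B].

Definition P4 (V : finType) (Delta : {set {set V}})
    (proj : {set V} -> {set V} -> {set V}) (bar : {set V} -> {set V}) : Prop :=
  forall G C, codim1_face Delta G -> C \in chambers Delta ->
    proj G C <> proj G (bar C).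

Definition R4 (V : finType) (Delta : {set {set V}})
    (proj : {set V} -> {set V} -> {set V}) (bar : {set V} -> {set V}) : Prop :=
  forall C D, C \in chambers Delta -> D \in chambers Delta ->
    complementary_in D (restriction proj C D) (restriction proj (bar C) D).

Definition S4 (V : finType) (Delta : {set {set V}})
    (proj : {set V} -> {set V} -> {set V}) (bar : {set V} -> {set V}) : Prop :=
  forall C, C \in chambers Delta ->
  forall D E, D \in chambers Delta -> E \in chambers Delta ->
    le_chamber Delta proj C D E <-> le_chamber Delta proj (bar C) E D.

(* A labelling by I maps the vertices of each chamber bijectively onto I; the  *)
(* type of a face F is then lab @: F.                                          *)
Definition labelling (V T : finType) (Delta : {set {set V}}) (I : {set T})
    (lab : V -> T) : Prop :=
  forall C, C \in chambers Delta -> {in C &, injective lab} /\ lab @: C = I.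

Definition R4_labelled (V T : finType) (Delta : {set {set V}})
    (proj : {set V} -> {set V} -> {set V}) (bar : {set V} -> {set V})
    (I : {set T}) (lab : V -> T) : Prop :=
  forall C D, C \in chambers Delta -> D \in chambers Delta ->
    lab @: restriction proj C D = I :\: lab @: restriction proj (bar C) D.

(* Main.v *)
(** For a face [F] of a chamber [D], [FC = D] holds exactly when [R_C(D) <= F];
    hence [E -> D] is a generator of [<=_C] exactly when it is a step of a weak
    [C]-gallery, and (P3) says that such galleries never return to a chamber
    that they have left. (P4) and (R4) are equivalent because a codimension-one
    face lies in exactly two chambers. For (R4) => (S4), let [R_C(E) <= D]. As
    long as some vertex of [D] outside [F = R_C(E)] is not in the
    [Cbar]-restriction of [D], crossing the opposite codimension-one face moves
    [D] strictly up in [<=_Cbar] and keeps it above [F]; at the end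
    [R_C(D) <= F], so that [D = FC = E]. For (S4) => (P4), if
    [GC = GCbar = D] and [D'] is the other chamber on [G], then [D <= D'] in
    both orders. *)

Require Import Defs.
From mathcomp Require Import all_boot.
From Stdlib Require Import Relation_Operators.

Set Implicit Arguments.
Unset Strict Implicit.
Unset Printing Implicit Defensive.

Lemma imset_inj_in (V T : finType) (f : V -> T) (D A B : {set V}) :
    {in D &, injective f} -> A \subset D -> B \subset D ->
  f @: A = f @: B -> A = B.
Proof.
move=> injf.
suffices sub (X Y : {set V}) : X \subset D -> Y \subset D -> f @: X = f @: Y -> X \subset Y.
  by move=> sA sB eqf; apply/eqP; rewrite eqEsubset; apply/andP; split; apply: sub.
move=> /subsetP sX /subsetP sY eqf; apply/subsetP=> v vX.
have: f v \in f @: Y by rewrite -eqf imset_f.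
by case/imsetP=> w wY /(injf _ _ (sX _ vX) (sY _ wY)) ->.
Qed.

Lemma imset_setD_in (V T : finType) (f : V -> T) (D B : {set V}) :
    {in D &, injective f} -> B \subset D ->
  f @: (D :\: B) = f @: D :\: f @: B.
Proof.
move=> injf /subsetP sB; apply/setP=> t; apply/imsetP/setDP.
  case=> v /setDP[vD vB] ->; split; first exact: imset_f.
  by apply: contra vB => /imsetP[w wB /(injf _ _ vD (sB _ wB)) ->].
case=> /imsetP[v vD ->] fvB; exists v => //.
by rewrite inE vD andbT; apply: contra fvB; exact: imset_f.
Qed.

Lemma codim1_inP (V : finType) (G D : {set V}) :
  reflect (exists2 v, v \in D & G = D :\ v) (codim1_in G D).
Proof.
apply: (iffP andP) => [[sGD /eqP cD] | [v vD ->]]; last first.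
  by rewrite subD1set (cardsD1 v D) vD.
have /cards1P[v Dv]: #|D :\: G| == 1.
  by rewrite cardsD (setIidPr sGD) cD subSnn.
exists v; first by have := set11 v; rewrite -Dv => /setDP[].
by rewrite -Dv setDDr setDv set0U (setIidPr sGD).
Qed.

Lemma complementary_inC (V : finType) (D A B : {set V}) :
  complementary_in D A B -> complementary_in D B A.
Proof. by case=> UAB dAB; split; rewrite ?[B :|: A]setUC // disjoint_sym. Qed.

(** The form [A = D :\: B] commutes with taking images under an injective map, which is what the
    passage to types requires. *)
Lemma complementary_inP (V : finType) (D A B : {set V}) :
  A \subset D -> B \subset D ->
  complementary_in D A B <-> A = D :\: B.
Proof.
move=> sAD sBD; split=> [[<- dAB] | ->].
  by rewrite setDUl setDv setU0; apply/esym/setDidPl.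
split; first by rewrite setUC -{1}(setIidPr sBD) setID.
by rewrite -setI_eq0 setIDAC setDIl setDv setI0.
Qed.

Lemma restriction_sub (V : finType) (proj : {set V} -> {set V} -> {set V})
  (C D : {set V}) : restriction proj C D \subset D.
Proof. by apply/subsetP => v; rewrite inE => /andP[]. Qed.

Section Projection.

Variables (V : finType) (Delta : {set {set V}}).
Variable proj : {set V} -> {set V} -> {set V}.
Implicit Types (C D E F G X Y : {set V}).
Hypotheses (hDelta : chamber_complex Delta) (hthin : thin Delta).
Hypotheses (hproj : projection_map Delta proj).
Hypothesis hax : projection_axioms Delta proj.

Notation chamber := (chambers Delta).
Notation R := (restriction proj).

Lemma chamber_face F D : D \in chamber -> F \subset D -> F \in Delta.
Proof.
case: hDelta => [[_ closed] _ _]; rewrite inE => /maxsetP[faceD _].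
exact: closed.
Qed.

(** [G] has codimension one in some chamber, hence by purity in every chamber that contains it, in
    particular in [proj G C] by (P1)(i). *)
Lemma codim1_face_proj G C : codim1_face Delta G -> C \in chamber ->
  proj G C \in chamber /\ codim1_in G (proj G C).
Proof.
case/exists_inP=> D chD codimGD chC; have [sGD /eqP cD] := andP codimGD.
have faceG := chamber_face chD sGD.
have chX := hproj faceG chC.
split=> //; rewrite /codim1_in (axP1i hax faceG chC chX erefl) /=.
by case: hDelta => _ /(_ _ _ chX chD) -> _; rewrite cD.
Qed.

Lemma thin_cases G X Y D : codim1_face Delta G ->
    X \in chamber -> Y \in chamber -> D \in chamber ->
    G \subset X -> G \subset Y -> G \subset D -> X != Y ->
  D = X \/ D = Y.
Proof.
move=> /hthin cG chX chY chD sX sY sD neqXY.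
have /eqP eqS: [set X; Y] == [set D in chamber | G \subset D].
  rewrite eqEcard cG cards2 neqXY andbT; apply/subsetP=> Z.
  by case/set2P=> ->; rewrite inE; apply/andP.
by apply/set2P; rewrite eqS inE; apply/andP.
Qed.

Lemma thin_other G D : D \in chamber -> codim1_in G D ->
  exists D', [/\ D' \in chamber, G \subset D' & D' != D].
Proof.
move=> chD codimGD; have [sGD _] := andP codimGD.
have /hthin : codim1_face Delta G by apply/exists_inP; exists D.
rewrite (cardsD1 D) inE chD sGD => -[] /eqP/cards1P[D' eqD'].
have := set11 D'; rewrite -eqD' => /setD1P[neq]; rewrite inE => /andP[chD' sG].
by exists D'.
Qed.

(** Left to right, (P1)(iii) passes from [F] to each [D :\ v] with [v] outside [F], so such a [v] is
    not in [R C D]. Right to left is (P2): a face [D :\ v] above [F] omits a vertex outside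
    [R C D]. *)
Lemma proj_restriction F C D : C \in chamber -> D \in chamber ->
  F \subset D -> (proj F C == D) = (R C D \subset F).
Proof.
move=> chC chD sFD; have faceF := chamber_face chD sFD; apply/eqP/idP.
  move=> FC; apply/subsetP=> v; rewrite inE => /andP[vD]; apply: contraR => vF.
  have sFDv: F \subset D :\ v by rewrite subsetD1 sFD.
  have sDvD := subD1set D v.
  by apply/eqP; apply: (axP1iii hax faceF) (chamber_face chD sDvD) _ _ FC _ _.
move=> sRF; apply: (axP2 hax) => // G sFG /codim1_inP[v vD defG].
apply/eqP; rewrite defG; apply/negPn/negP=> neq.
have /(subsetP sRF)/(subsetP sFG): v \in R C D by rewrite inE vD.
by rewrite defG setD11.
Qed.

Lemma mem_restriction C D v : v \in D -> (v \in R C D) = (proj (D :\ v) C != D).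
Proof. by move=> vD; rewrite inE vD. Qed.

Definition le_step C : rel {set V} :=
  [rel E D | [&& E \in chamber, D \in chamber & R C E \subset D]].

Lemma le_stepP C E D : reflect (le_gen Delta proj C E D) (le_step C E D).
Proof. exact: and3P. Qed.

(** [connect] is reflexive and a transitive closure need not be; on chambers the two agree because
    [R C D] is a face of [D], so each chamber is related to itself by a generator. *)
Lemma le_chamberP C D E : D \in chamber ->
  reflect (le_chamber Delta proj C D E) (connect (le_step C) D E).
Proof.
move=> chD; apply: (iffP idP) => [/connectP[p + ->]|]; last first.
  elim=> [X Y /le_stepP/connect1 // | X Y Z _ cXY _ cYZ].
  exact: connect_trans cXY cYZ.
have refl X: X \in chamber -> le_chamber Delta proj C X X.
  by move=> chX; apply: t_step; split=> //; exact: restriction_sub.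
elim: p D chD => [|X p IHp] D chD /=; first by move=> _; exact: refl.
case/andP=> /le_stepP gDX pathX; apply: t_trans (t_step _ _ _ _ gDX) _.
by apply: IHp pathX; case: gDX.
Qed.

Lemma le_step_gallery C D p : C \in chamber -> D \in chamber ->
  path (le_step C) D p -> weak_gallery Delta proj C D p.
Proof.
move=> chC; rewrite /weak_gallery; elim: p D => [|X p IHp] D chD /=.
  by rewrite chD.
case/andP=> /and3P[_ chX sRX] /(IHp _ chX)/= /andP[-> ->].
rewrite chD !andbT /=; apply/exists_inP; exists (R C D).
  exact: chamber_face chD (restriction_sub _ _ _).
by rewrite proj_restriction ?restriction_sub ?subxx.
Qed.

(** With F = [R C D], FC = D and F lies in [E], so FE = E by (P1)(ii). Applied to the weak gallery
    from [E] back to [D], (P3) gives FE = D. *)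
Lemma le_step_antisym C D E : C \in chamber ->
  le_step C D E -> connect (le_step C) E D -> D = E.
Proof.
move=> chC /and3P[chD chE sRE] /connectP[p pathE lastE].
have sRD := restriction_sub proj C D.
have faceR := chamber_face chD sRD.
have RC: proj (R C D) C = D by apply/eqP; rewrite proj_restriction.
rewrite -(axP1ii hax faceR chE sRE); apply/esym.
exact: (axP3 hax faceR chC chD RC (le_step_gallery chC chE pathE)).
Qed.

Lemma le_step_dual C C' D E : C \in chamber -> C' \in chamber ->
    (forall X, X \in chamber -> complementary_in X (R C X) (R C' X)) ->
  le_step C E D -> connect (le_step C') D E.
Proof.
move=> chC chC' compl /and3P[chE chD].
have RCE: proj (R C E) C = E.
  by apply/eqP; rewrite proj_restriction ?restriction_sub.
(* Only FC = E and F <= D matter from here on; [F] stays fixed while [D] varies. *)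
move: (R C E) RCE => F FC.
(* Induction on the number of chambers above [D] in the order of [C']. *)
have [n] := ubnP #|connect (le_step C') D|.
elim: n D chD => // n IHn D chD; rewrite ltnS => leDn sFD.
have [sDR | /subsetPn[v /setDP[vD vF] vR]] := boolP (D :\: F \subset R C' D).
  suffices /eqP <-: proj F C == D by rewrite FC.
  rewrite proj_restriction //.
  (* A vertex of [R C D] outside [F] would also lie in [R C' D], against disjointness. *)
  have [_ dRR'] := compl _ chD.
  apply/subsetP=> v vR; apply: contraFT (disjointFr dRR' vR) => vF.
  by apply: (subsetP sDR); rewrite inE vF (subsetP (restriction_sub _ _ _) _ vR).
have codimD: codim1_in (D :\ v) D by apply/codim1_inP; exists v.
have [D' [chD' sD' neqD']] := thin_other chD codimD.
have stepD: le_step C' D D'.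
  apply/and3P; split=> //; apply: subset_trans sD'.
  by rewrite subsetD1 restriction_sub.
apply: connect_trans (connect1 stepD) _; apply: IHn => //.
  (* Everything above [D'] is above [D], but [D] is not above [D'], by antisymmetry. *)
  apply: leq_trans leDn; apply: proper_card; apply/properP; split.
    by apply/subsetP=> X; apply: connect_trans (connect1 stepD).
  exists D; first exact: connect0.
  apply: contra neqD' => cD'D.
  by rewrite (le_step_antisym chC' stepD cD'D).
by apply: subset_trans sD'; rewrite subsetD1 sFD.
Qed.

Lemma le_chamber_dual C C' D E : C \in chamber -> C' \in chamber ->
    (forall X, X \in chamber -> complementary_in X (R C X) (R C' X)) ->
  le_chamber Delta proj C D E -> le_chamber Delta proj C' E D.
Proof.
move=> chC chC' compl; elim=> [X Y genXY | X Y Z _ leYX _ leZY]; last first.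
  exact: t_trans leZY leYX.
case: (genXY) => chX chY _; apply/le_chamberP => //.
exact: le_step_dual chC chC' compl (introT (le_stepP _ _ _) genXY).
Qed.

Variable bar : {set V} -> {set V}.
Hypothesis hbar : forall C, C \in chamber -> bar C \in chamber.

Lemma P4_R4 : P4 Delta proj bar -> R4 Delta proj bar.
Proof.
move=> p4 C D chC chD.
apply/complementary_inP; rewrite ?restriction_sub //; apply/setP=> v.
rewrite in_setD; have [vD|] := boolP (v \in D); last first.
  by rewrite andbF => /(contraNF (subsetP (restriction_sub proj C D) v)) ->.
rewrite !mem_restriction // negbK andbT.
have codimD: codim1_in (D :\ v) D by apply/codim1_inP; exists v.
have faceG: codim1_face Delta (D :\ v) by apply/exists_inP; exists D.
have neq := introN eqP (p4 _ _ faceG chC).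
have [chX /andP[sX _]] := codim1_face_proj faceG chC.
have [chY /andP[sY _]] := codim1_face_proj faceG (hbar chC).
(* By thinness [D] is exactly one of the distinct chambers [proj (D :\ v) C] and
   [proj (D :\ v) (bar C)], so [v] lies in exactly one restriction. *)
have := thin_cases faceG chX chY chD sX sY (subD1set _ _) neq.
move: neq; move: (proj _ C) (proj _ (bar C)) => X Y neq [] ->.
  by rewrite eqxx eq_sym (negbTE neq).
by rewrite neq eqxx.
Qed.

Lemma R4_S4 : R4 Delta proj bar -> S4 Delta proj bar.
Proof.
move=> r4 C chC D E _ _; split; apply: le_chamber_dual => //; auto.
by move=> X chX; apply: complementary_inC; apply: r4.
Qed.

Lemma S4_P4 : S4 Delta proj bar -> P4 Delta proj bar.
Proof.
move=> s4 G C faceG chC eqGC.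
have [chD codimG] := codim1_face_proj faceG chC.
have [sGD _] := andP codimG.
have [D' [chD' sGD' /eqP[]]] := thin_other chD codimG.
have step X : X \in chamber -> proj G X = proj G C ->
    le_step X (proj G C) D'.
  move=> chX eqX; apply/and3P; split=> //; apply: subset_trans sGD'.
  by rewrite -proj_restriction ?eqX.
(* (S4) turns the step from [proj G C] to [D'] in the order of [bar C] into a return path in the
   order of [C], which antisymmetry forbids for distinct chambers. *)
apply/esym/(le_step_antisym chC (step C chC erefl)).
apply/le_chamberP => //; apply/s4 => //; apply/le_chamberP => //.
exact/connect1/step/esym/eqGC/hbar.
Qed.

End Projection.

Lemma R4_labelledP (V T : finType) (Delta : {set {set V}})
    (proj : {set V} -> {set V} -> {set V}) (bar : {set V} -> {set V})
    (I : {set T}) (lab : V -> T) :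
  labelling Delta I lab ->
  (R4 Delta proj bar <-> R4_labelled Delta proj bar I lab).
Proof.
move=> hlab.
have equiv C D : D \in chambers Delta ->
    complementary_in D (restriction proj C D) (restriction proj (bar C) D) <->
    lab @: restriction proj C D = I :\: lab @: restriction proj (bar C) D.
  move=> /hlab[injD <-].
  have sA := restriction_sub proj C D.
  have sB := restriction_sub proj (bar C) D.
  apply: iff_trans (complementary_inP sA sB) _.
  rewrite -imset_setD_in //; split=> [-> // |].
  by apply: imset_inj_in injD _ _ => //; exact: subsetDl.
by split=> h C D chC chD; apply/equiv => //; apply: h.
Qed.

Theorem theorem9p4 (V : finType) (Delta : {set {set V}})
    (proj : {set V} -> {set V} -> {set V}) (bar : {set V} -> {set V})
    (hDelta : chamber_complex Delta) (hthin : thin Delta)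
    (hproj : projection_map Delta proj)
    (hax : projection_axioms Delta proj)
    (hbar : forall C, C \in chambers Delta -> bar C \in chambers Delta) :
  [<-> P4 Delta proj bar; R4 Delta proj bar; S4 Delta proj bar] /\
  (forall (T : finType) (I : {set T}) (lab : V -> T),
     labelling Delta I lab ->
     (R4 Delta proj bar <-> R4_labelled Delta proj bar I lab)).
Proof.
split; last by move=> T I lab; apply: R4_labelledP.
by tfae; [apply: P4_R4 | apply: R4_S4 | apply: S4_P4].
Qed.
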